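(* For every $T_0$ space $X$ there exist a well-filtered space $W(X)$ and a continuous mapping $\eta_X: X\to W(X)$ that is universal from $X$ to well-filtered spaces, i.e. for every well-filtered space $Y$ and every continuous mapping $f: X\to Y$ there is a unique continuous mapping $\hat f: W(X)\to Y$ such that $f=\hat f\circ \eta_X$.
   Context: For a topological space $X$ and $A\subseteq X$, the saturation of $A$ is $sat(A)=\bigcap\{U : U \text{ open in } X,\ A\subseteq U\}$, and $A$ is saturated if $A=sat(A)$. Compact means every open cover has a finite subcover (no separation axiom is assumed). A nonempty family $\mathcal F$ of saturated compact subsets of $X$ is filtered if for any $F_1,F_2\in\mathcal F$ there is $F_3\in\mathcal F$ with $F_3\subseteq F_1\cap F_2$. A $T_0$ space $X$ is well-filtered if for every open set $U\subseteq X$ and every filtered family $\mathcal F$ of saturated compact subsets of $X$, $\bigcap\mathcal F\subseteq U$ implies $F\subseteq U$ for some $F\in\mathcal F$. (In particular well-filtered spaces are $T_0$ by definition.) *)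

(* Defs.v *)
From mathcomp Require Import all_boot all_order.
From mathcomp Require Import boolp classical_sets topology.

Set Implicit Arguments.
Unset Strict Implicit.
Unset Printing Implicit Defensive.

Local Open Scope classical_set_scope.

Definition saturation (X : topologicalType) (A : set X) : set X :=
  \bigcap_(U in [set U : set X | open U /\ A `<=` U]) U.

Definition saturated (X : topologicalType) (A : set X) : Prop :=
  A = saturation A.

(* Compactness is [cover_compact]: the library relates it to the filter-based
   [compact] only for pointed spaces, whereas spaces may be empty here. *)
Definition filtered_compacts (X : topologicalType) (FF : set (set X)) : Prop :=
  [/\ FF !=set0,
      forall F, FF F -> saturated F /\ cover_compact F
    & forall F1 F2, FF F1 -> FF F2 ->
        exists2 F3, FF F3 & F3 `<=` F1 `&` F2].

(* [kolmogorov_space] is the T0 axiom. *)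
Definition well_filtered (X : topologicalType) : Prop :=
  kolmogorov_space X /\
  forall (U : set X) (FF : set (set X)),
    open U -> filtered_compacts FF ->
    \bigcap_(F in FF) F `<=` U -> exists2 F, FF F & F `<=` U.

(* Main.v *)
Require Import Defs.
From HB Require Import structures.
From mathcomp Require Import all_boot all_order.
From mathcomp Require Import finmap.
From mathcomp Require Import boolp classical_sets topology.

(** The reflection is built from the closed irreducible subsets of [X].  Call a
set [K] determined when, for every continuous [f] from [X] to a well-filtered
space, the closure of [f @` K] is the closure of a point.  The points of [W]
are the closed irreducible determined sets, and the open sets of [W] are the
sets [hit U] of all points meeting a given open [U] of [X].  The map [eta]
sends [x] to the closure of [x].

A continuous [f : X -> Y] with [Y] well-filtered extends to [W] by sending [K]
to the point whose closure is that of [f @` K]; this is what determinedness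
provides.  The extension is unique because [hit U] is recovered from its
preimage [U] under [eta], so that two continuous extensions have the same
preimages of open sets and agree since [Y] is T0.

The point is that [W] is well-filtered.  Let a filtered family of compact
saturated sets have no member inside the open set [U].  By compactness and
Zorn's lemma there is a maximal open [O] containing [U] and no member of the
family ([maximal_open_avoiding]); by maximality its complement is irreducible
(Rudin's lemma, [maximal_open_prime]).  Moreover, for every continuous [g] into
a well-filtered space [Y], the image under [g] of the complement of [O] has a
generic point ([maximal_open_generic]): well-filteredness of [Y], applied to
the saturations of the sets [g @` (F `\` O)], gives a point [y] of all of them
in the closure of the image, and maximality of [O] forces [y] to be generic.
Taking for [g] the extensions to [W] of maps on [X], one sees that
[K := eta @^-1` (~` O)] is determined, hence is a point of [W].  This point is
outside [O], and it belongs to every [F] of the family: some [D] in [F] is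
outside [O], which means [D `<=` K], and [F] is saturated.  So the
intersection of the family is not contained in [U]. *)

Set Implicit Arguments.
Unset Strict Implicit.
Unset Printing Implicit Defensive.

Local Open Scope classical_set_scope.

(** * T0 spaces, saturation and compactness *)

Lemma kolmogorov_spaceP (T : topologicalType) :
  kolmogorov_space T <->
  forall x y : T, (forall V, open V -> V x <-> V y) -> x = y.
Proof.
split=> [T0 x y xy|T0 x y /eqP nxy].
  apply: contrapT => /eqP /T0[A]; rewrite !in_setE !nbhsE.
  case=> -[[B [oB Bp] BA] nA]; apply: nA; apply: BA; exact/(xy _ oB).
apply: contrapT => noA; apply: nxy; apply: T0 => V oV; split=> Vp;
  apply: contrapT => nV; apply: noA; exists V; rewrite !in_setE.
  by left; split=> //; exact: open_nbhs_nbhs.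
by right; split=> //; exact: open_nbhs_nbhs.
Qed.

Lemma closure1_meets (T : topologicalType) (x : T) (U : set T) :
  open U -> closure [set x] `&` U !=set0 <-> U x.
Proof.
move=> oU; split=> [[z [clz Uz]]|Ux].
  by have [_ [-> //]] := clz U (open_nbhs_nbhs (conj oU Uz)).
by exists x; split=> //; exact: subset_closure.
Qed.

Lemma sub_saturation (T : topologicalType) (A : set T) : A `<=` saturation A.
Proof. by move=> x Ax U [_ AU]; exact: AU. Qed.

Lemma saturation_subopen (T : topologicalType) (A U : set T) :
  open U -> A `<=` U -> saturation A `<=` U.
Proof. by move=> oU AU x; apply. Qed.

Lemma saturationS (T : topologicalType) (A B : set T) :
  A `<=` B -> saturation A `<=` saturation B.
Proof. by move=> AB x Ax U [oU BU]; apply: Ax; split=> // z /AB/BU. Qed.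

Lemma saturated_saturation (T : topologicalType) (A : set T) :
  saturated (saturation A).
Proof.
apply/seteqP; split; first exact: sub_saturation.
by move=> x Ax U [oU AU]; apply: Ax; split=> //; exact: saturation_subopen.
Qed.

Lemma cover_compact_saturation (T : topologicalType) (A : set T) :
  cover_compact A -> cover_compact (saturation A).
Proof.
move=> cA I D f oD Af.
have [|D' D'D AD'] := cA I D f oD; first by move=> x /sub_saturation/Af.
exists D' => //; apply: saturation_subopen AD'; apply: bigcup_open => i iD'.
by apply: oD; apply/set_mem/D'D.
Qed.

Lemma cover_compact_image (S T : topologicalType) (g : S -> T) (A : set S) :
  continuous g -> cover_compact A -> cover_compact (g @` A).
Proof.
move=> cg cA I D f oD Af.
have [i Di|x Ax|D' D'D AD'] := cA I D (fun i => g @^-1` f i).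
- by move/continuousP: cg; apply; exact: oD.
- by have [i Di fi] := Af _ (imageP g Ax); exists i.
by exists D' => // _ [x Ax <-]; have [i Di fi] := AD' _ Ax; exists i.
Qed.

Lemma cover_compactD (T : topologicalType) (A O : set T) :
  cover_compact A -> open O -> cover_compact (A `\` O).
Proof.
move=> cA oO I D f oD Af.
(* The open cover of [A `\` O], together with [O] at index [None], covers [A]. *)
pose h (i : option I) := if i is Some j then f j else O.
have [[i|] //|x Ax|D' D'D AD'] :=
  cA _ [set i | if i is Some j then D j else True] h.
- exact: oD.
- have [Ox|nOx] := pselect (O x); first by exists None.
  by have [i Di fi] := Af x (conj Ax nOx); exists (Some i).
have memD i : (i \in [fset i in pmap id (enum_fset D')]%fset) = (Some i \in D').
  by rewrite in_fset /= mem_pmap map_id.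
exists [fset i in pmap id (enum_fset D')]%fset.
  by move=> i; rewrite memD => /D'D /set_mem /= Di; exact: mem_set.
move=> x [Ax nOx]; have [[i|] //= iD' hx] := AD' x Ax.
by exists i => //=; rewrite memD.
Qed.

Lemma cover_compact_chain (T : topologicalType) (A : set T) (C : set (set T)) :
  cover_compact A -> C !=set0 -> (forall O, C O -> open O) ->
  total_on C subset -> A `<=` \bigcup_(O in C) O -> exists2 O, C O & A `<=` O.
Proof.
move=> cA [O0 CO0] oC tC AC.
have [D DC AD] := cA _ C id oC AC.
suff [O CO DO] : exists2 O, C O & forall B, B \in enum_fset D -> B `<=` O.
  by exists O => // x /AD[B BD Bx]; exact: (DO B).
have {}DC B : B \in enum_fset D -> C B by move=> /DC /set_mem.
elim: (enum_fset D) DC => [|B s IHs] sC; first by exists O0.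
have [|O CO sO] := IHs; first by move=> B' B's; apply: sC; rewrite inE B's orbT.
have CB : C B by apply: sC; rewrite inE eqxx.
have [BO|OB] := tC _ _ CB CO.
  by exists O => // B'; rewrite inE => /orP[/eqP->|/sO].
by exists B => // B'; rewrite inE => /orP[/eqP->|/sO B'O x /B'O/OB].
Qed.

(** * Maximal open sets avoiding a filtered family of compact sets *)

(** No member of the family [FF] is contained in [O]. *)
Definition avoids (T : Type) (FF : set (set T)) (O : set T) :=
  forall F, FF F -> ~ F `<=` O.

(** [O] is maximal, for inclusion, among the open sets containing no member of
[FF].  In terms of the closed set [~` O]: it is minimal among the closed sets
meeting every member of [FF]. *)
Definition maximal_avoiding (T : topologicalType) (FF : set (set T))
    (O : set T) :=
  [/\ open O, avoids FF O
    & forall O', open O' -> O `<=` O' -> avoids FF O' -> O' `<=` O].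

Lemma maximal_open_avoiding (T : topologicalType) (FF : set (set T))
    (U : set T) :
  (forall F, FF F -> cover_compact F) -> open U -> avoids FF U ->
  exists2 O, U `<=` O & maximal_avoiding FF O.
Proof.
move=> cFF oU aU.
(* The union with [U] makes the empty chain harmless. *)
have [C CP tC|O [[oO aO] mO]] :=
    @Zorn_bigcup T (fun O => open O /\ avoids FF (O `|` U)).
  split; first by apply: bigcup_open => O /CP[].
  move=> F FFF FC.
  have [||||O CO FO] := @cover_compact_chain T F
      (U |` [set O `|` U | O in C]) (cFF _ FFF).
  - by exists U; left.
  - by move=> _ [->//|[O /CP[oO _] <-]]; exact: openU.
  - move=> _ _ [->|[O1 CO1 <-]] [->|[O2 CO2 <-]].
    + by left.
    + by left=> x; right.
    + by right=> x; right.
    + by have [O12|O21] := tC _ _ CO1 CO2; [left|right]; exact: setSU.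
  - move=> x /FC[[O CO Ox]|Ux]; last by exists U => //; left.
    by exists (O `|` U); [right; exists O|left].
  - case: CO FO => [->|[O' /CP[_ aO'] <-]]; [exact: aU|exact: aO'].
exists (O `|` U); first exact: subsetUr.
split=> // [|O' oO' OO' aO']; first exact: openU.
apply: contrapT => nO'; apply: (mO O').
  split=> [x Ox|O'O]; first by apply: OO'; left.
  by apply: nO' => x /O'O; left.
split=> // F FFF; rewrite setUidl; first exact: aO'.
by move=> x Ux; apply: OO'; right.
Qed.

(** Rudin's lemma: the complement of a maximal [O] is irreducible. *)
Lemma maximal_open_prime (T : topologicalType) (FF : set (set T))
    (O A B : set T) :
  (forall F1 F2, FF F1 -> FF F2 -> exists2 F3, FF F3 & F3 `<=` F1 `&` F2) ->
  maximal_avoiding FF O -> open A -> open B ->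
  A `&` B `<=` O -> A `<=` O \/ B `<=` O.
Proof.
move=> FFI [oO aO mO] oA oB ABO.
have meets G : open G -> ~ G `<=` O -> exists2 F, FF F & F `<=` O `|` G.
  move=> oG nGO; apply: contrapT => noF; apply: nGO => x Gx.
  apply: (mO (O `|` G)); [exact: openU|exact: subsetUl| |by right].
  by move=> F FFF FO; apply: noF; exists F.
apply: contrapT => /not_orP[/(meets _ oA)[F1 FF1 F1A] /(meets _ oB)[F2 FF2 F2B]].
have [F3 FF3 F3I] := FFI _ _ FF1 FF2.
apply: (aO _ FF3) => x /F3I[/F1A[//|Ax] /F2B[//|Bx]]; exact: ABO.
Qed.

(** [generic_point A y] says that [closure A = closure [set y]]. *)
Definition generic_point (Y : topologicalType) (A : set Y) (y : Y) :=
  forall V, open V -> V y <-> A `&` V !=set0.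

(** The complement of a maximal [O] behaves like the closure of a point as far as
continuous maps to well-filtered spaces can tell. *)
Lemma maximal_open_generic (T Y : topologicalType) (FF : set (set T))
    (O : set T) (g : T -> Y) :
  filtered_compacts FF -> maximal_avoiding FF O ->
  well_filtered Y -> continuous g ->
  exists y, generic_point (g @` (~` O)) y.
Proof.
move=> [[F0 FF0] cFF FFI] [oO aO mO] [_ wfY] cg.
have opre V : open V -> open (g @^-1` V) by move/continuousP: cg; apply.
(* [V0] is the complement of the closure of the image. *)
pose V0 := \bigcup_(V in [set V | open V /\ g @^-1` V `<=` O]) V.
pose G := [set saturation (g @` (F `\` O)) | F in FF].
have [y Gy nV0y] : exists2 y, (\bigcap_(F in G) F) y & ~ V0 y.
  apply: contrapT => noy.
  have [|||_ [F FFF <-] sV0] := wfY V0 G.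
  - by apply: bigcup_open => V [].
  - split.
    + by exists (saturation (g @` (F0 `\` O))), F0.
    + move=> _ [F /cFF[_ cF] <-]; split; first exact: saturated_saturation.
      by apply/cover_compact_saturation/cover_compact_image/cover_compactD.
    + move=> _ _ [F1 FF1 <-] [F2 FF2 <-].
      have [F3 FF3 F3I] := FFI _ _ FF1 FF2.
      exists (saturation (g @` (F3 `\` O))); first by exists F3.
      by move=> y F3y; split; move: y F3y;
        apply: saturationS => _ [x [F3x nOx] <-];
        exists x => //; split=> //; have [] := F3I x F3x.
  - by move=> y Gy; apply: contrapT => nV0y; apply: noy; exists y.
  apply: (aO _ FFF) => x Fx; apply: contrapT => nOx.
  have [|V [_ VO] Vx] := sV0 (g x); last exact/nOx/VO.
  by apply: sub_saturation; exists x.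
exists y => V oV; split=> [Vy|[_ [[z nOz <-] Vz]]].
  apply: contrapT => nV; apply: nV0y; exists V => //; split=> // z Vz.
  by apply: contrapT => nOz; apply: nV; exists (g z); split=> //; exists z.
apply: contrapT => nVy; apply: nOz.
apply: (mO (O `|` g @^-1` V));
  [by apply: openU => //; exact: opre|exact: subsetUl| |by right].
move=> F FFF FO; apply: nVy.
apply: (Gy (saturation (g @` (F `\` O)))); first by exists F.
by split=> // _ [x [Fx nOx] <-]; case: (FO x Fx).
Qed.

(** * The space of determined closed irreducible sets *)

(** Irreducible sets are nonempty and are stated by means of open sets: two open
sets that meet [A] have an intersection that meets [A]. *)
Definition irreducible (T : topologicalType) (A : set T) :=
  A !=set0 /\ forall U V, open U -> open V ->
    A `&` U !=set0 -> A `&` V !=set0 -> A `&` (U `&` V) !=set0.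

(** Every continuous map to a well-filtered space sends [K] to a set with a generic
point.  The quantification ranges over all spaces [Y]; as [determined K] is a
proposition, this does not raise the universe level of the type of such [K]. *)
Definition determined (X : topologicalType) (K : set X) :=
  forall (Y : topologicalType) (f : X -> Y),
    well_filtered Y -> continuous f -> exists y, generic_point (f @` K) y.

(** The points of the well-filtered reflection of [X]. *)
Record well_filterification (X : topologicalType) := WellFilterification {
  wf_set :> set X;
  wf_closed : closed wf_set;
  wf_irreducible : irreducible wf_set;
  wf_determined : determined wf_set }.

Lemma wf_set_inj (X : topologicalType) : injective (@wf_set X).
Proof.
move=> [A cA iA dA] [B cB iB dB] /= AB; move: cA iA dA; rewrite AB => *.
by congr WellFilterification; exact: Prop_irrelevance.
Qed.

(** The points that meet [U].  The sets [hit U] with [U] open are all the open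
sets of [well_filterification X], not merely a base. *)
Definition hit (X : topologicalType) (U : set X) :
  set (well_filterification X) := [set K | wf_set K `&` U !=set0].

Section Topology.
Variable X : topologicalType.

Let hit_open : set_system (well_filterification X) :=
  [set S | exists2 U, open U & S = hit U].

Let hit_openT : hit_open setT.
Proof.
exists setT; first exact: openT.
apply/seteqP; split=> // K _; rewrite /hit /= setIT.
by have [] := wf_irreducible K.
Qed.

Let hit_openI : setI_closed hit_open.
Proof.
move=> _ _ [U oU ->] [V oV ->]; exists (U `&` V); first exact: openI.
apply/seteqP; split=> K.
  by move=> [KU KV]; have [_ irrK] := wf_irreducible K; exact: irrK.
by move=> [x [Kx [Ux Vx]]]; split; exists x.
Qed.

Let hit_open_bigcup (I : Type) (f : I -> set (well_filterification X)) :
  (forall i, hit_open (f i)) -> hit_open (\bigcup_i f i).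
Proof.
move=> of_; exists (\bigcup_(U in [set U | open U /\ exists i, f i = hit U]) U).
  by apply: bigcup_open => U [].
apply/seteqP; split=> K.
  move=> [i _ fiK]; have [U oU fiU] := of_ i.
  move: fiK; rewrite fiU => -[x [Kx Ux]].
  by exists x; split=> //; exists U => //; split=> //; exists i.
by move=> [x [Kx [U [oU [i fiU]] Ux]]]; exists i => //; rewrite fiU; exists x.
Qed.

HB.instance Definition _ := gen_eqMixin (well_filterification X).
HB.instance Definition _ := gen_choiceMixin (well_filterification X).
HB.instance Definition _ := isOpenTopological.Build (well_filterification X)
  hit_openT hit_openI hit_open_bigcup.

End Topology.

Section Reflection.
Variable X : topologicalType.

Lemma irreducible_closure1 (x : X) : irreducible (closure [set x]).
Proof.
split; first by exists x; exact: subset_closure.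
move=> U V oU oV /(closure1_meets _ oU) Ux /(closure1_meets _ oV) Vx.
by apply/closure1_meets; [exact: openI|split].
Qed.

Lemma determined_closure1 (x : X) : determined (closure [set x]).
Proof.
move=> Y f _ cf; exists (f x) => V oV.
have oU : open (f @^-1` V) by move/continuousP: cf; apply.
rewrite -[V (f x)]/((f @^-1` V) x) -(closure1_meets _ oU).
split=> [[z [clz Vz]]|[_ [[z clz <-] Vz]]]; last by exists z.
by exists (f z); split=> //; exists z.
Qed.

(** The unit of the reflection: a point goes to its closure. *)
Definition wf_unit (x : X) : well_filterification X :=
  WellFilterification (@closed_closure _ [set x])
    (irreducible_closure1 x) (determined_closure1 x).

Lemma wf_unit_hit (U : set X) : open U -> wf_unit @^-1` hit U = U.
Proof. by move=> oU; apply/seteqP; split=> x /(closure1_meets x oU). Qed.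

Lemma continuous_wf_unit : continuous wf_unit.
Proof. by apply/continuousP => _ [U oU ->]; rewrite wf_unit_hit. Qed.

Lemma open_hit (U : set X) : open U -> open (hit U).
Proof. by move=> oU; exists U. Qed.

(** An open set of [well_filterification X] is determined by its preimage in [X];
hence both the uniqueness of extensions and the translation of maximal open sets
back to [X]. *)
Lemma hit_wf_unit (S : set (well_filterification X)) :
  open S -> S = hit (wf_unit @^-1` S).
Proof. by move=> [U oU ->]; rewrite wf_unit_hit. Qed.

Lemma kolmogorov_well_filterification :
  kolmogorov_space (well_filterification X).
Proof.
apply/kolmogorov_spaceP => K L KL; apply: wf_set_inj.
have sub (A B : well_filterification X) :
    (forall V, open V -> V A <-> V B) -> wf_set A `<=` wf_set B.
  move=> AB x Ax; apply: contrapT => nBx.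
  have oC : open (~` wf_set B) by rewrite openC; exact: wf_closed.
  have [] := (AB _ (open_hit oC)).1; first by exists x.
  by move=> z [].
by apply/seteqP; split; apply: sub => // V oV; rewrite KL.
Qed.

(** * Extension of maps to well-filtered spaces *)

(** The extension is described by its preimages of open sets; that it extends [f]
follows when [Y] is T0. *)
Lemma wf_extension (Y : topologicalType) (f : X -> Y) :
  well_filtered Y -> continuous f ->
  exists fhat : well_filterification X -> Y,
    continuous fhat /\
    forall V, open V -> fhat @^-1` V = hit (f @^-1` V).
Proof.
move=> wfY cf.
have [fhat fhatP] := choice (fun K => wf_determined K wfY cf).
have fhatV V : open V -> fhat @^-1` V = hit (f @^-1` V).
  move=> oV; apply/seteqP; split=> K /=.
    by move=> /(fhatP K _ oV)[_ [[z Kz <-] Vz]]; exists z.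
  by move=> [z [Kz Vz]]; apply/(fhatP K _ oV); exists (f z); split=> //; exists z.
exists fhat; split=> //; apply/continuousP => V oV; rewrite fhatV //.
by apply: open_hit; move/continuousP: cf; apply.
Qed.

Lemma wf_extension_unique (Y : topologicalType)
    (g h : well_filterification X -> Y) :
  kolmogorov_space Y -> continuous g -> continuous h ->
  g \o wf_unit = h \o wf_unit -> g = h.
Proof.
move=> /kolmogorov_spaceP T0 /continuousP cg /continuousP ch gh.
apply/funext => K; apply: T0 => V oV.
have ghV : g @^-1` V = h @^-1` V.
  rewrite (hit_wf_unit (cg V oV)) (hit_wf_unit (ch V oV)); congr hit.
  exact: (congr1 (fun k => k @^-1` V) gh).
by rewrite -[V (g K)]/((g @^-1` V) K) ghV.
Qed.

(** * The space of determined closed irreducible sets is well-filtered *)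

Lemma well_filtered_well_filterification :
  well_filtered (well_filterification X).
Proof.
split=> [|U FF oU FFP capU]; first exact: kolmogorov_well_filterification.
apply: contrapT => noF.
have [[F0 FF0] cFF FFI] := FFP.
have aU : avoids FF U by move=> F FFF FU; apply: noF; exists F.
have [O UO maxO] := maximal_open_avoiding (fun F FFF => (cFF F FFF).2) oU aU.
have [oO aO _] := maxO.
pose A := wf_unit @^-1` O.
have oA : open A by move/continuousP: continuous_wf_unit; apply.
have OA : O = hit A by exact: hit_wf_unit.
have subA (D : well_filterification X) : ~ O D -> wf_set D `<=` ~` A.
  by move=> nOD x Dx Ax; apply: nOD; rewrite OA; exists x.
have notO F : FF F -> exists2 D, F D & ~ O D.
  move=> FFF; apply: contrapT => noD; apply: (aO F FFF) => D FD.
  by apply: contrapT => nOD; apply: noD; exists D.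
have clK : closed (~` A) by rewrite closedC.
have irrK : irreducible (~` A).
  split=> [|V1 V2 oV1 oV2 [x [nAx V1x]] [y [nAy V2y]]].
    have [D _ /subA DA] := notO _ FF0.
    by have [[x /DA nAx] _] := wf_irreducible D; exists x.
  apply: contrapT => noV.
  have VO : hit V1 `&` hit V2 `<=` O.
    rewrite OA => D [DV1 DV2].
    have [z [Dz Vz]] := (wf_irreducible D).2 V1 V2 oV1 oV2 DV1 DV2.
    by exists z; split=> //; apply: contrapT => nAz; apply: noV; exists z.
  have [V1O|V2O] :=
    maximal_open_prime FFI maxO (open_hit oV1) (open_hit oV2) VO.
    by apply: nAx; apply: V1O; apply/closure1_meets.
  by apply: nAy; apply: V2O; apply/closure1_meets.
have detK : determined (~` A).
  move=> Y f wfY cf; have [fhat [cfhat fhatV]] := wf_extension wfY cf.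
  (* The images of [~` A] under [f] and of [~` O] under [fhat] meet the same open
     sets, so they have the same generic points. *)
  have [y yP] := maximal_open_generic FFP maxO wfY cfhat.
  exists y => V oV; apply: (iff_trans (yP V oV)).
  split=> [[_ [[D nOD <-] VD]]|[_ [[x nAx <-] Vx]]].
    have : (fhat @^-1` V) D by [].
    rewrite fhatV // => -[x [Dx Vx]].
    by exists (f x); split=> //; exists x => //; exact: subA Dx.
  exists (fhat (wf_unit x)); split; first by exists (wf_unit x).
  rewrite -[V _]/((fhat @^-1` V) (wf_unit x)) fhatV //.
  by exists x; split=> //; exact: subset_closure.
pose K := WellFilterification clK irrK detK.
have nOK : ~ O K by rewrite OA => -[x [nAx Ax]]; exact: nAx.
apply/nOK/UO/capU => F FFF; have [-> _] := cFF F FFF.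
(* A point [D] of [F] outside [O] is contained in [K], so every open set around
   [F] contains [K]. *)
have [D FD /subA DK] := notO F FFF.
move=> _ [[V oV ->] /(_ D FD)[x [Dx Vx]]].
by exists x; split=> //; exact: DK.
Qed.

End Reflection.

Theorem theorem1 (X : topologicalType) (hX : kolmogorov_space X) :
  exists (W : topologicalType) (eta : X -> W),
    [/\ well_filtered W, continuous eta
      & forall (Y : topologicalType) (f : X -> Y),
          well_filtered Y -> continuous f ->
          exists! fhat : W -> Y, continuous fhat /\ f = fhat \o eta].
Proof.
exists (well_filterification X), (@wf_unit X); split.
- exact: well_filtered_well_filterification.
- exact: continuous_wf_unit.
move=> Y f wfY cf; have [T0Y _] := wfY.
have [fhat [cfhat fhatV]] := wf_extension wfY cf.
have ffhat : f = fhat \o @wf_unit X.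
  apply/funext => x; move/kolmogorov_spaceP: T0Y; apply=> V oV.
  have oU : open (f @^-1` V) by move/continuousP: cf; apply.
  rewrite -[V (f x)]/((f @^-1` V) x) -{1}(wf_unit_hit oU).
  by rewrite -[V ((_ \o _) x)]/((fhat @^-1` V) (wf_unit x)) fhatV.
exists fhat; split=> // g [cg fg].
by apply: wf_extension_unique => //; rewrite -ffhat -fg.
Qed.
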